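(* Let $I=(U,R)$ be an approximation space (a non-empty finite set $U$ with an equivalence relation $R$ on $U$), and let $(T,\Delta,\nabla)$ be its rough semiring. Then the pseudocomplemented rough semiring $(T,\Delta,\nabla,{}^{*},RS(\emptyset),RS(U))$ is a rough Stone algebra, i.e. $RS(X)^{*}\,\Delta\, RS(X)^{**}=RS(U)$ for all $RS(X)\in T$.
   Context: Setting. $U$ is a non-empty finite set, $R$ an equivalence relation on $U$, $[x]_R$ the class of $x$. For $X\subseteq U$ put $R_{-}(X)=\{x\in U: [x]_R\subseteq X\}$, $R^{-}(X)=\{x\in U: [x]_R\cap X\neq\emptyset\}$. The rough set of $X$ is $RS(X)=(R_{-}(X),R^{-}(X))$, and $T=\{RS(X): X\subseteq U\}$. $T$ is ordered componentwise: $RS(X)\le RS(Y)$ iff $R_{-}(X)\subseteq R_{-}(Y)$ and $R^{-}(X)\subseteq R^{-}(Y)$. Operations on subsets of $U$. Let $IW(X)$ be the number of equivalence classes contained in $X$. Praba join: if $IW(X\cup Y)=IW(X)+IW(Y)-IW(X\cap Y)$ then $X\Delta Y=X\cup Y$. If $IW(X\cup Y)>IW(X)+IW(Y)-IW(X\cap Y)$, one identifies an equivalence class newly formed by the union (contained in $X\cup Y$ but in neither $X$ nor $Y$), deletes from $Y$ its elements belonging to that class, calls the result $Y$ again, and repeats until equality holds; then $X\Delta Y$ is the union of $X$ and the final $Y$. Praba meet: $x$ is a pivot element of $X,Y$ if $[x]_R\not\subseteq X\cap Y$, $[x]_R\cap X\ne\emptyset$ and $[x]_R\cap Y\neq\emptyset$;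 the pivot set $P_{X\cap Y}$ consists of one representative pivot element for each such class; $X\nabla Y=\{x\in U:[x]_R\subseteq X\cap Y\}\cup P_{X\cap Y}$. Operations on $T$. $RS(X)\Delta RS(Y)=RS(X\Delta Y)$ and $RS(X)\nabla RS(Y)=RS(X\nabla Y)$; it is known that these are respectively the least upper bound and the greatest lower bound of $RS(X),RS(Y)$ in $T$, and that $(T,\Delta,\nabla)$ is a semiring, called the rough semiring. $RS(\emptyset)$ and $RS(U)$ are the least and greatest elements of $T$. Definitions. The pseudocomplement of $RS(X)\in T$ is the greatest element $RS(X)^{*}$ of $\{RS(Y)\in T: RS(X)\nabla RS(Y)=RS(\emptyset)\}$; $RS(X)^{**}$ denotes $(RS(X)^{*})^{*}$. A pseudocomplemented rough semiring $(T,\Delta,\nabla,{}^{*},RS(\emptyset),RS(U))$ is a rough semiring with least element $RS(\emptyset)$ in which every element has a pseudocomplement. It is called a rough Stone algebra if $RS(X)^{*}\Delta RS(X)^{**}=RS(U)$ for all $RS(X)\in T$. *)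

(* Defs.v *)
From HB Require Import structures.
From mathcomp Require Import all_boot all_order all_algebra.
Set Implicit Arguments.
Unset Strict Implicit.
Unset Printing Implicit Defensive.
Import Order.TTheory.

Record approxSpace := ApproxSpace {
  universe :> finType;
  indisc : rel universe;
  indisc_equiv : equivalence_rel indisc;
  universe_gt0 : 0 < #|universe| }.

Section Subsets.
Variable I : approxSpace.
Implicit Types (X Y Z P C : {set I}) (x y z : I).

Definition eqclass x : {set I} := [set y | indisc x y].

Definition lower X : {set I} := [set x | eqclass x \subset X].
Definition upper X : {set I} := [set x | eqclass x :&: X != set0].

Definition rough_pair X : {set I} * {set I} := (lower X, upper X).

Definition classes_in X : {set {set I}} :=
  [set C in equivalence_partition (@indisc I) setT | C \subset X].

Definition IW X : nat := #|classes_in X|.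

Definition newly_formed X Y : {set {set I}} :=
  [set C in classes_in (X :|: Y) | ~~ (C \subset X) && ~~ (C \subset Y)].

(* [praba_join_run X Y Z]: the join procedure, started on X and Y, can return Z;
   the class to delete is an arbitrary newly formed one at each round.  The
   subtraction is never truncated, since IW (X :&: Y) <= IW X. *)
Inductive praba_join_run X : {set I} -> {set I} -> Prop :=
| PrabaJoinStop Y of
    IW (X :|: Y) = IW X + IW Y - IW (X :&: Y) :
    praba_join_run X Y (X :|: Y)
| PrabaJoinStep Y C Z of
    IW (X :|: Y) > IW X + IW Y - IW (X :&: Y)
    & C \in newly_formed X Y
    & praba_join_run X (Y :\: C) Z :
    praba_join_run X Y Z.

Definition pivots X Y : {set I} :=
  [set x | [&& ~~ (eqclass x \subset X :&: Y),
               eqclass x :&: X != set0 & eqclass x :&: Y != set0]].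

(* One representative from each indiscernibility class of pivots. *)
Definition pivot_set X Y P : bool :=
  is_transversal P (equivalence_partition (@indisc I) (pivots X Y))
                 (pivots X Y).

Definition praba_meet_with X Y P : {set I} := lower (X :&: Y) :|: P.

Lemma eqclass_refl x : x \in eqclass x.
Proof. by rewrite inE (indisc_equiv x x x). Qed.

Lemma eqclass_eq x y : y \in eqclass x -> eqclass y = eqclass x.
Proof.
rewrite inE => xy; apply/setP=> z; rewrite !inE.
by have [_ ->] := indisc_equiv x y z.
Qed.

Lemma mem_classes_in X C :
  reflect (exists2 x, C = eqclass x & eqclass x \subset X)
          (C \in classes_in X).
Proof.
have E x : [set y in setT | indisc x y] = eqclass x.
  by apply/setP=> y; rewrite !inE.
rewrite inE; apply: (iffP andP) => [[/imsetP[x _ ->]]|[x -> sx]].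
  by rewrite E => sx; exists x.
by split=> //; apply/imsetP; exists x; rewrite ?inE ?E.
Qed.

Lemma IW_newly_formed X Y :
  IW (X :|: Y) = IW X + IW Y - IW (X :&: Y) + #|newly_formed X Y|.
Proof.
have -> : newly_formed X Y =
    classes_in (X :|: Y) :\: (classes_in X :|: classes_in Y).
  apply/setP=> C; rewrite !inE.
  by case: (C \in equivalence_partition _ _); rewrite ?andbF //= negb_or andbC.
rewrite /IW.
have -> : classes_in (X :&: Y) = classes_in X :&: classes_in Y.
  apply/setP=> C; rewrite !inE subsetI.
  by case: (C \in equivalence_partition _ _).
rewrite -cardsU.
have s : classes_in X :|: classes_in Y \subset classes_in (X :|: Y).
  apply/subsetP=> C; rewrite !inE.
  case: (C \in equivalence_partition _ _) => //= /orP[] h.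
    exact: subset_trans h (subsetUl _ _).
  exact: subset_trans h (subsetUr _ _).
by rewrite cardsD (setIidPr s) subnKC // subset_leq_card.
Qed.

Lemma praba_join_ex X Y : {Z | praba_join_run X Y Z}.
Proof.
have [n] := ubnP #|Y|; elim: n Y => // n IHn Y ltYn.
case: (pickP (mem (newly_formed X Y))) => [C /= nC|n0].
  have [sCU nsX] : C \subset X :|: Y /\ ~~ (C \subset X).
    by move: nC; rewrite inE => /and3P[/mem_classes_in[x -> ?]].
  have [|Z rZ] := IHn (Y :\: C).
    apply: leq_trans (_ : #|Y| <= n); last by rewrite -ltnS.
    case/subsetPn: nsX => y Cy nXy.
    have Yy : y \in Y by move/subsetP/(_ y Cy): sCU; rewrite inE (negPf nXy).
    apply: proper_card; apply/properP; split; first exact: subsetDl.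
    by exists y; rewrite // inE Cy.
  exists Z; apply: (PrabaJoinStep _ nC rZ).
  rewrite IW_newly_formed -[X in X < _]addn0 ltn_add2l.
  by rewrite card_gt0; apply/set0Pn; exists C.
exists (X :|: Y); apply: PrabaJoinStop.
by rewrite IW_newly_formed eq_card0 ?addn0.
Qed.

(* [praba_join] and [praba_meet] fix one outcome of the choices left open by the
   procedures; [transversal] picks one pivot in each class. *)
Definition praba_join X Y : {set I} := sval (praba_join_ex X Y).

Definition praba_meet X Y : {set I} :=
  praba_meet_with X Y
    (transversal (equivalence_partition (@indisc I) (pivots X Y))
                 (pivots X Y)).

Lemma praba_joinP X Y : praba_join_run X Y (praba_join X Y).
Proof. exact: svalP (praba_join_ex X Y). Qed.

Lemma equivalence_partition_pivots X Y :
  partition (equivalence_partition (@indisc I) (pivots X Y)) (pivots X Y).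
Proof.
by apply: equivalence_partitionP => x y z _ _ _; exact: indisc_equiv.
Qed.

Lemma praba_meetP X Y :
  exists2 P, pivot_set X Y P & praba_meet X Y = praba_meet_with X Y P.
Proof.
exists (transversal (equivalence_partition (@indisc I) (pivots X Y))
                    (pivots X Y)) => //.
exact/transversalP/equivalence_partition_pivots.
Qed.

Lemma upperP X x : reflect (exists2 y, y \in eqclass x & y \in X)
                           (x \in upper X).
Proof.
rewrite inE; apply: (iffP (set0Pn _)) => [[y /setIP[]]|[y xy Xy]]; exists y => //.
by rewrite inE xy.
Qed.

Lemma rough_pair_join_run X Y Z : praba_join_run X Y Z ->
  rough_pair Z = (lower X :|: lower Y, upper X :|: upper Y).
Proof.
elim=> {Y Z} [Y eqIW|Y C Z _ nC _ ->].
  congr (_, _); apply/setP=> x; rewrite [RHS]inE.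
    rewrite !inE; apply/idP/orP=> [sU|[]s]; last first.
    - exact: subset_trans s (subsetUr _ _).
    - exact: subset_trans s (subsetUl _ _).
    have n0 : newly_formed X Y = set0.
      apply/eqP; rewrite -cards_eq0 -(eqn_add2l (IW X + IW Y - IW (X :&: Y))).
      by rewrite -IW_newly_formed eqIW addn0.
    apply/orP; have /setP/(_ (eqclass x)) := n0; rewrite !inE sU andbT.
    have -> /= : eqclass x \in equivalence_partition (@indisc I) setT.
      have /mem_classes_in : exists2 y, eqclass x = eqclass y
        & eqclass y \subset setT by exists x; rewrite ?subsetT.
      by rewrite inE => /andP[].
    by rewrite -negb_or => /negbFE.
  by rewrite !inE setIUr setU_eq0 negb_and.
move: nC; rewrite inE => /and3P[/mem_classes_in[c -> scU] ncX ncY].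
congr (_, _); apply/setP=> x; rewrite [LHS]inE [RHS]inE.
  congr (_ || _); rewrite !inE; apply/idP/idP => [s|s].
    exact: subset_trans s (subsetDl _ _).
  rewrite subsetD s /=; apply/pred0P=> y /=; apply/andP=> -[xy cy].
  by move: ncY; rewrite -(eqclass_eq cy) (eqclass_eq xy) s.
case: (boolP (x \in upper X)) => //= nX; apply/upperP/upperP.
  by case=> y xy /setDP[Yy _]; exists y.
case=> y xy Yy; exists y => //; rewrite inE Yy andbT.
apply: contra nX => cy; case/subsetPn: ncY => w cw nYw.
apply/upperP; exists w; first by rewrite -(eqclass_eq xy) (eqclass_eq cy).
by move/subsetP/(_ w cw): scU; rewrite inE (negPf nYw) orbF.
Qed.

Lemma rough_pair_meet X Y P : pivot_set X Y P ->
  rough_pair (praba_meet_with X Y P) =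
  (lower X :&: lower Y, upper X :&: upper Y).
Proof.
case/and3P=> _ /subsetP sP /forallP tP.
have PP x : x \in pivots X Y -> exists2 p, (p \in P) && (p \in eqclass x) &
    forall q, q \in eqclass x -> q \in P -> q = p.
  move=> px; set B := [set y in pivots X Y | indisc x y].
  have BP : B \in equivalence_partition (@indisc I) (pivots X Y).
    exact: imset_f.
  have /implyP/(_ BP)/cards1P[p Ep] := tP B.
  exists p.
    by have := set11 p; rewrite -Ep !inE => /and3P[-> _ ->].
  move=> q xq Pq; apply/set1P; rewrite -Ep !inE Pq.
  by have := sP q Pq; rewrite inE => -> /=; move: xq; rewrite inE.
congr (_, _); apply/setP=> x; rewrite [RHS]inE.
  rewrite !inE -subsetI; apply/idP/idP=> s; last first.
    by apply/subsetP=> y xy; rewrite !inE (eqclass_eq xy) s.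
  apply/idPn=> ns.
  have disj y : y \in eqclass x -> y \in P.
    move=> xy; move/subsetP/(_ y xy): s; rewrite !inE (eqclass_eq xy).
    by rewrite (negPf ns).
  have px : x \in pivots X Y by apply/sP/disj/eqclass_refl.
  have [p _ pu] := PP x px.
  have xE y : y \in eqclass x -> y = x.
    by move=> xy; rewrite (pu _ xy (disj _ xy)) (pu _ (eqclass_refl x)) // disj // eqclass_refl.
  move: px; rewrite inE (negPf ns) /=.
  case/andP=> /set0Pn[a /setIP[/xE-> Xx]] /set0Pn[b /setIP[/xE-> Yx]].
  case/negP: ns; apply/subsetP=> y /xE->; exact/setIP.
apply/upperP/andP=> [[y xy]|[ux uy]].
  rewrite !inE -(eqclass_eq xy) => /orP[s|/sP].
    have /setIP[Xy Yy] := subsetP s y (eqclass_refl y).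
    by split; apply/set0Pn; exists y; rewrite inE eqclass_refl ?Xy ?Yy.
  by rewrite inE => /and3P[].
case: (boolP (eqclass x \subset X :&: Y)) => [s|ns].
  by exists x; rewrite ?eqclass_refl // !inE s.
have [|p /andP[Pp xp] _] := PP x; last by exists p; rewrite // inE Pp orbT.
by move: ux uy; rewrite !inE ns => -> ->.
Qed.

End Subsets.

Section RoughSets.
Variable I : approxSpace.
Implicit Types (X Y Z P : {set I}).

Record rough := Rough {
  rough_val : {set I} * {set I};
  rough_valP : rough_val \in codom (@rough_pair I) }.

HB.instance Definition _ := [isSub for rough_val].
HB.instance Definition _ := [Finite of rough by <:].

Implicit Types x y z : rough.

Definition RS X : rough := Rough (codom_f (@rough_pair I) X).

Definition representative x : {set I} := iinv (rough_valP x).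

Definition rough_le x y : bool :=
  ((rough_val x).1 \subset (rough_val y).1) &&
  ((rough_val x).2 \subset (rough_val y).2).

(* These do not depend on the representatives, nor on the choices made by
   [praba_join] and [praba_meet]: see [rough_join_RS] and [rough_meet_RS]. *)
Definition rough_join x y : rough :=
  RS (praba_join (representative x) (representative y)).
Definition rough_meet x y : rough :=
  RS (praba_meet (representative x) (representative y)).

Lemma rough_val_inj : injective rough_val.
Proof. exact: val_inj. Qed.

Lemma representativeK : cancel representative RS.
Proof. by move=> x; apply: val_inj; rewrite /= f_iinv. Qed.

Lemma rough_joinE x y : rough_val (rough_join x y) =
  ((rough_val x).1 :|: (rough_val y).1, (rough_val x).2 :|: (rough_val y).2).
Proof.
rewrite -{2 3}(representativeK x) -{2 3}(representativeK y).
exact/rough_pair_join_run/praba_joinP.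
Qed.

Lemma rough_meetE x y : rough_val (rough_meet x y) =
  ((rough_val x).1 :&: (rough_val y).1, (rough_val x).2 :&: (rough_val y).2).
Proof.
rewrite -{2 3}(representativeK x) -{2 3}(representativeK y).
have [P pP /= ->] := praba_meetP (representative x) (representative y).
exact: rough_pair_meet.
Qed.

Lemma rough_join_RS X Y Z : praba_join_run X Y Z ->
  rough_join (RS X) (RS Y) = RS Z.
Proof.
by move=> r; apply: rough_val_inj; rewrite rough_joinE; exact/esym/rough_pair_join_run.
Qed.

Lemma rough_meet_RS X Y P : pivot_set X Y P ->
  rough_meet (RS X) (RS Y) = RS (praba_meet_with X Y P).
Proof.
by move=> r; apply: rough_val_inj; rewrite rough_meetE; exact/esym/rough_pair_meet.
Qed.

Lemma rough_val_RS0 : rough_val (RS set0) = (set0, set0).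
Proof.
congr (_, _); apply/setP=> x; rewrite !inE ?setI0 ?eqxx //.
by rewrite subset0; apply/negbTE/set0Pn; exists x; exact: eqclass_refl.
Qed.

Lemma rough_val_RST : rough_val (RS setT) = (setT, setT).
Proof.
congr (_, _); apply/setP=> x; rewrite !inE ?subsetT //.
by rewrite setIT; apply/set0Pn; exists x; exact: eqclass_refl.
Qed.

Fact rough_joinC : commutative rough_join.
Proof.
move=> x y; apply: rough_val_inj.
by rewrite !rough_joinE setUC [in X in (_, X)]setUC.
Qed.

Fact rough_meetC : commutative rough_meet.
Proof.
move=> x y; apply: rough_val_inj.
by rewrite !rough_meetE setIC [in X in (_, X)]setIC.
Qed.

Fact rough_joinA : associative rough_join.
Proof.
by move=> x y z; apply: rough_val_inj; rewrite !rough_joinE /= !setUA.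
Qed.

Fact rough_meetA : associative rough_meet.
Proof.
by move=> x y z; apply: rough_val_inj; rewrite !rough_meetE /= !setIA.
Qed.

Fact rough_joinKI y x : rough_meet x (rough_join x y) = x.
Proof.
apply: rough_val_inj; rewrite rough_meetE rough_joinE /=.
case: (rough_val x) => a b /=; congr (_, _); apply/setIidPl/subsetUl.
Qed.

Fact rough_meetKU y x : rough_join x (rough_meet x y) = x.
Proof.
apply: rough_val_inj; rewrite rough_joinE rough_meetE /=.
case: (rough_val x) => a b /=; congr (_, _); apply/setUidPl/subsetIl.
Qed.

Fact rough_meetUl : left_distributive rough_meet rough_join.
Proof.
move=> x y z; apply: rough_val_inj.
by rewrite !(rough_joinE, rough_meetE) /= !setIUl.
Qed.

Fact rough_meetxx : idempotent_op rough_meet.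
Proof.
move=> x; apply: rough_val_inj.
by rewrite rough_meetE !setIid; case: (rough_val x).
Qed.

Fact rough_le_def x y : rough_le x y = (rough_meet x y == x).
Proof.
rewrite -(inj_eq rough_val_inj) rough_meetE /rough_le.
case: (rough_val x) => a b; rewrite xpair_eqE.
by congr (_ && _); apply/setIidPl/eqP.
Qed.

Fact rough_le0x x : rough_le (RS set0) x.
Proof. by rewrite /rough_le rough_val_RS0 !sub0set. Qed.

Fact rough_lex1 x : rough_le x (RS setT).
Proof. by rewrite /rough_le rough_val_RST !subsetT. Qed.

(* Records that the join and the meet are the least upper and greatest lower
   bounds for [rough_le]. *)
HB.instance Definition _ :=
  Order.isMeetJoinDistrLattice.Build (Order.Disp tt tt) rough
    rough_le_def (fun _ _ => erefl) rough_meetC rough_joinC rough_meetA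
    rough_joinA rough_joinKI rough_meetKU rough_meetUl rough_meetxx.
HB.instance Definition _ :=
  Order.hasBottom.Build (Order.Disp tt tt) rough rough_le0x.
HB.instance Definition _ :=
  Order.hasTop.Build (Order.Disp tt tt) rough rough_lex1.

Fact rough_join0x : left_id (RS set0) rough_join.
Proof. exact: (@join0x _ rough). Qed.

Fact rough_meet1x : left_id (RS setT) rough_meet.
Proof. exact: (@meet1x _ rough). Qed.

Fact rough_meet0x : left_zero (RS set0) rough_meet.
Proof. exact: (@meet0x _ rough). Qed.

Fact RST_neq0 : RS setT != RS set0.
Proof.
rewrite -(inj_eq rough_val_inj) rough_val_RS0 rough_val_RST xpair_eqE andbb.
by rewrite -cards_eq0 cardsT -lt0n universe_gt0.
Qed.

(* The rough semiring: addition is [rough_join], multiplication [rough_meet]. *)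
HB.instance Definition _ :=
  GRing.isNmodule.Build rough rough_joinA rough_joinC rough_join0x.
HB.instance Definition _ :=
  GRing.Nmodule_isComNzSemiRing.Build rough
    rough_meetA rough_meetC rough_meet1x rough_meetUl rough_meet0x RST_neq0.

Definition is_pseudocomplement x y : Prop :=
  rough_meet x y = RS set0 /\
  (forall z, rough_meet x z = RS set0 -> rough_le z y).

Definition pseudocomplementation (star : rough -> rough) : Prop :=
  forall x, is_pseudocomplement x (star x).

Definition rough_Stone_algebra (star : rough -> rough) : Prop :=
  pseudocomplementation star /\
  (forall X, rough_join (star (RS X)) (star (star (RS X))) = RS setT).

End RoughSets.

(* Main.v *)
(** The pseudocomplement of [RS X] is [RS (~: upper X)].  Since [upper X] is a
    union of classes, so is its complement; such a set has equal approximations,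
    so [RS X ^*] and [RS X ^**] are the pairs [(~: upper X, ~: upper X)] and
    [(upper X, upper X)], whose join is the top. *)
Require Import Defs.
From mathcomp Require Import all_boot all_order all_algebra.

Lemma lower_setC {I : approxSpace} (X : {set I}) : lower (~: X) = ~: upper X.
Proof.
by apply/setP => x; rewrite !inE negbK setI_eq0 disjoints_subset.
Qed.

Lemma lower_sub {I : approxSpace} (X : {set I}) : lower X \subset X.
Proof.
by apply/subsetP => x; rewrite inE => /subsetP/(_ x (eqclass_refl x)).
Qed.

Lemma sub_upper {I : approxSpace} (X : {set I}) : X \subset upper X.
Proof.
by apply/subsetP => x Xx; apply/upperP; exists x; rewrite ?eqclass_refl.
Qed.

(** Membership in [upper X] depends only on the class of a point, by [eqclass_eq]; the same argument
    serves for its complement below. *)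
Lemma upper_idem {I : approxSpace} (X : {set I}) : upper (upper X) = upper X.
Proof.
by apply/setP => x; apply/upperP/idP => [[y xy]|Xx];
  [rewrite !inE (eqclass_eq xy) | exists x; rewrite ?eqclass_refl].
Qed.

Lemma upper_setC_upper {I : approxSpace} (X : {set I}) :
  upper (~: upper X) = ~: upper X.
Proof.
apply/setP => x; apply/upperP/idP => [[y xy]|Xx].
  by rewrite !inE (eqclass_eq xy).
by exists x; rewrite ?eqclass_refl.
Qed.

(** Built from the upper approximation, which [x] itself carries, so no representative has to be
    chosen. *)
Definition rough_pcompl {I : approxSpace} (x : rough I) : rough I :=
  RS (~: (rough_val x).2).

Lemma rough_val_pcompl {I : approxSpace} (x : rough I) :
  rough_val (rough_pcompl x) = (~: (rough_val x).2, ~: (rough_val x).2).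
Proof.
rewrite -(representativeK x) /rough_pcompl /= /rough_pair.
by rewrite lower_setC upper_idem upper_setC_upper.
Qed.

Lemma rough_val_sub {I : approxSpace} (x : rough I) :
  (rough_val x).1 \subset (rough_val x).2.
Proof.
rewrite -(representativeK x) /=.
exact: subset_trans (lower_sub _) (sub_upper _).
Qed.

Lemma rough_pcomplP {I : approxSpace} : pseudocomplementation (@rough_pcompl I).
Proof.
move=> x; split=> [|z /(congr1 (@rough_val I))].
  apply: rough_val_inj; rewrite rough_meetE rough_val_pcompl rough_val_RS0 /=.
  congr (_, _); last exact: setICr.
  by apply/eqP; rewrite setI_eq0 disjoints_subset setCK rough_val_sub.
(* Disjointness of the upper approximations puts that of [z] inside the complement; the lower one
   follows, being contained in the upper one. *)
rewrite rough_meetE rough_val_RS0 => -[_ /eqP].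
rewrite setIC setI_eq0 disjoints_subset /rough_le rough_val_pcompl /= => sz.
by rewrite sz (subset_trans (rough_val_sub z)).
Qed.

(** Each of the two is below the other by maximality. This carries the computation for
    [rough_pcompl] over to an arbitrary [star]. *)
Lemma pseudocomplement_unique {I : approxSpace} {x y z : rough I} :
  is_pseudocomplement x y -> is_pseudocomplement x z -> y = z.
Proof.
move=> [xy0 ymax] [xz0 zmax].
by apply: (@Order.POrderTheory.le_anti _ (rough I)); apply/andP; split;
  [apply: zmax | apply: ymax].
Qed.

Theorem lemma1 (I : approxSpace) :
  (exists star : rough I -> rough I, pseudocomplementation star) /\
  (forall star : rough I -> rough I,
     pseudocomplementation star -> rough_Stone_algebra star).
Proof.
split; first by exists rough_pcompl; exact: rough_pcomplP.
move=> star starP; split=> // X.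
have starE x : star x = rough_pcompl x.
  exact: pseudocomplement_unique (starP x) (rough_pcomplP x).
apply: rough_val_inj.
(* Both components of the join have the form [A :|: ~: A] with [A = ~: upper X]. *)
by rewrite !starE rough_joinE !rough_val_pcompl rough_val_RST /= setUCr.
Qed.
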